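(* Let $e$ be an expression and $n$ an integer. If $\mathcal{E}[\![e]\!]\emptyset=\mathcal{E}[\![n]\!]\emptyset$ (where $\emptyset$ is the empty environment), then $e\Downarrow n$, i.e. $\emptyset\vdash e\Rightarrow n$ in the big-step operational semantics.
   Context: **Expressions.** $e ::= n \mid e\oplus e \mid x \mid \lambda x.\,e \mid e\;e \mid \mathbf{if}\,e\,\mathbf{then}\,e\,\mathbf{else}\,e$, with $n\in\mathbb{Z}$, $x$ a variable, and $\oplus\in\{+,\times,-,\ldots\}$ a total binary integer operation. **Domain.** $\mathbb{D}$ is inductively defined by $\mathbb{D}=\mathbb{Z}+\mathcal{P}_f(\mathbb{D}\times\mathbb{D})$ ($\mathcal{P}_f$ = finite subsets); $d$ ranges over $\mathbb{D}$, $t$ over finite subsets of $\mathbb{D}\times\mathbb{D}$ (''tables''). The order $\sqsubseteq$ on $\mathbb{D}$: $n\sqsubseteq n$ for integers; $t\sqsubseteq t'$ iff $t\subseteq t'$; nothing else. **Semantics.** For an environment $\rho$ (partial map from variables to $\mathbb{D}$), $\mathcal{E}[\![e]\!]\rho\subseteq\mathbb{D}$ is defined by recursion on $e$: - $\mathcal{E}[\![n]\!]\rho=\{n\}$; $\mathcal{E}[\![x]\!]\rho=\{d\mid d\sqsubseteq\rho(x)\}$ (empty if $\rho(x)$ is undefined); - $\mathcal{E}[\![e_1\oplus e_2]\!]\rho=\{n_1\oplus n_2\mid n_1\in\mathcal{E}[\![e_1]\!]\rho,\ n_2\in\mathcal{E}[\![e_2]\!]\rho,\ n_1,n_2\in\mathbb{Z}\}$;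 - $\mathcal{E}[\![\lambda x.e]\!]\rho=\{t\mid\forall(d,d')\in t.\ d'\in\mathcal{E}[\![e]\!]\rho(x{:=}d)\}$; - $\mathcal{E}[\![e_1\,e_2]\!]\rho=\{d\mid\exists t,d_1,d_1',d_2.\ t\in\mathcal{E}[\![e_1]\!]\rho,\ d_2\in\mathcal{E}[\![e_2]\!]\rho,\ (d_1,d_1')\in t,\ d_1\sqsubseteq d_2,\ d\sqsubseteq d_1'\}$; - $\mathcal{E}[\![\mathbf{if}\,e_1\,\mathbf{then}\,e_2\,\mathbf{else}\,e_3]\!]\rho=\{d\mid\exists n\in\mathbb{Z}.\ n\in\mathcal{E}[\![e_1]\!]\rho,\ (n\ne0\Rightarrow d\in\mathcal{E}[\![e_2]\!]\rho),\ (n=0\Rightarrow d\in\mathcal{E}[\![e_3]\!]\rho)\}$. **Big-step semantics** (Kahn's natural semantics). Values are $v ::= n\mid\langle\lambda x.e,\varrho\rangle$ (closures), where $\varrho$ is a finite partial map from variables to values. $\varrho\vdash e\Rightarrow v$ is inductively defined by: $\varrho\vdash n\Rightarrow n$; $\varrho\vdash x\Rightarrow\varrho(x)$ if defined; $\varrho\vdash\lambda x.e\Rightarrow\langle\lambda x.e,\varrho\rangle$; if $\varrho\vdash e_1\Rightarrow n_1$ and $\varrho\vdash e_2\Rightarrow n_2$ then $\varrho\vdash e_1\oplus e_2\Rightarrow n_1\oplus n_2$; if $\varrho\vdash e_1\Rightarrow\langle\lambda x.e,\varrho'\rangle$, $\varrho\vdash e_2\Rightarrow v_2$ and $\varrho'(x{:=}v_2)\vdash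 e\Rightarrow v$ then $\varrho\vdash e_1\,e_2\Rightarrow v$; if $\varrho\vdash e_1\Rightarrow n$ with $n\neq0$ and $\varrho\vdash e_2\Rightarrow v$ then $\varrho\vdash\mathbf{if}\,e_1\,\mathbf{then}\,e_2\,\mathbf{else}\,e_3\Rightarrow v$; if $\varrho\vdash e_1\Rightarrow 0$ and $\varrho\vdash e_3\Rightarrow v$ then $\varrho\vdash\mathbf{if}\,e_1\,\mathbf{then}\,e_2\,\mathbf{else}\,e_3\Rightarrow v$. *)

(* Defs.v *)
From HB Require Import structures.
From mathcomp Require Import all_boot all_algebra finmap.
From mathcomp Require Import boolp classical_sets.

Set Implicit Arguments.
Unset Strict Implicit.
Unset Printing Implicit Defensive.

Local Open Scope fset_scope.

(* [op] ranges over all total binary integer operations. *)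
Inductive expr : Type :=
| ENum (n : int)
| EOp (op : int -> int -> int) (e1 e2 : expr)
| EVar (x : nat)
| ELam (x : nat) (e : expr)
| EApp (e1 e2 : expr)
| EIf (e1 e2 e3 : expr).

(* The domain D = Z + P_f(D * D).  Since [{fset _}] cannot be nested in an
   inductive type, a finite table is represented by its duplicate-free list of
   entries in the canonical order of finmap: [dom] is the type of hereditarily
   canonical trees, so that Leibniz equality on [dom] is equality of finite
   sets.  [dint] and [dtab] are the two injections; [dom_viewK], [dint_view],
   [dtab_view] and [dom_ind] below state that they present [dom] as the least
   solution of the domain equation. *)
Inductive tree : Type :=
| TInt (n : int)
| TTab (s : seq (tree * tree)).

Fixpoint tree_encode (r : tree) : GenTree.tree int :=
  match r with
  | TInt n => GenTree.Leaf n
  | TTab s => GenTree.Node 0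
      (map (fun p => GenTree.Node 0 [:: tree_encode p.1; tree_encode p.2]) s)
  end.

Fixpoint tree_decode (g : GenTree.tree int) : tree :=
  match g with
  | GenTree.Leaf n => TInt n
  | GenTree.Node _ s => TTab
      (map (fun h => match h with
                     | GenTree.Node _ [:: a; b] => (tree_decode a, tree_decode b)
                     | _ => (TInt 0, TInt 0)
                     end) s)
  end.

Lemma tree_nested_ind (P : tree -> Prop) :
  (forall n, P (TInt n)) ->
  (forall s, (forall i, i < size s ->
     P (nth (TInt 0, TInt 0) s i).1 /\ P (nth (TInt 0, TInt 0) s i).2) ->
     P (TTab s)) ->
  forall r, P r.
Proof.
move=> Pint Ptab; fix IH 1; case=> [n|s]; first exact: Pint.
apply: Ptab; elim: s => [|[a b] s IHs] i; first by [].
case: i => [_|i]; last exact: IHs i.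
by split; [exact: IH a | exact: IH b].
Qed.

Lemma tree_encodeK : cancel tree_encode tree_decode.
Proof.
elim/tree_nested_ind => //= s IHs; congr TTab; rewrite -map_comp.
apply: (@eq_from_nth _ (TInt 0, TInt 0)); rewrite size_map // => i lt_i_s.
rewrite (nth_map (TInt 0, TInt 0)) //=.
have [-> ->] := IHs i lt_i_s.
by case: (nth _ _ _).
Qed.

HB.instance Definition _ := Countable.copy tree (can_type tree_encodeK).

Fixpoint canonical_tree (r : tree) : bool :=
  match r with
  | TInt _ => true
  | TTab s => canonical_keys s &&
              all (fun p => canonical_tree p.1 && canonical_tree p.2) s
  end.

Definition dom : Type := {r : tree | canonical_tree r}.

HB.instance Definition _ := Countable.on dom.

Definition dint (n : int) : dom := exist _ (TInt n) isT.

Definition entry_tree (p : dom * dom) : tree * tree := (val p.1, val p.2).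

Lemma dtab_subproof (t : {fset dom * dom}) :
  canonical_tree (TTab (sort_keys (map entry_tree t))).
Proof.
rewrite /= canonical_sort_keys /=; apply/allP => q.
by rewrite sort_keysE => /mapP[p _ ->] /=; rewrite (valP p.1) (valP p.2).
Qed.

Definition dtab (t : {fset dom * dom}) : dom :=
  exist _ (TTab _) (dtab_subproof t).

Definition entry_dom (q : tree * tree) : option (dom * dom) :=
  match insub q.1, insub q.2 with
  | Some a, Some b => Some (a, b)
  | _, _ => None
  end.

Definition dom_view (d : dom) : int + {fset dom * dom} :=
  match val d with
  | TInt n => inl n
  | TTab s => inr [fset p in pmap entry_dom s]
  end.

Definition dom_of_view (v : int + {fset dom * dom}) : dom :=
  match v with inl n => dint n | inr t => dtab t end.

Lemma entry_treeK : pcancel entry_tree entry_dom.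
Proof. by case=> a b; rewrite /entry_dom /= !valK. Qed.

Lemma entry_domK : ocancel entry_dom entry_tree.
Proof.
case=> a b; rewrite /entry_dom /=.
case: insubP => //= u _ ua; case: insubP => //= v _ vb.
by rewrite /entry_tree /= ua vb.
Qed.

Lemma dint_view n : dom_view (dint n) = inl n.
Proof. by []. Qed.

Lemma dtab_view t : dom_view (dtab t) = inr t.
Proof.
congr inr; apply/fsetP => p; rewrite !inE /= mem_pmap.
apply/mapP/idP => [[q]|pt].
  by rewrite sort_keysE => /mapP[p' p't ->]; rewrite entry_treeK => -[->].
exists (entry_tree p); last by rewrite entry_treeK.
by rewrite sort_keysE map_f.
Qed.

Lemma dom_viewK : cancel dom_view dom_of_view.
Proof.
case=> [[n|s] cs]; apply: val_inj => //=; congr TTab.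
move: (cs) => /= /andP[/eqP sE /allP s_can].
rewrite -[RHS]sE; apply/eq_sort_keys => q; apply/mapP/idP => [[p]|qs].
  rewrite !inE /= mem_pmap => /mapP[q' q's pq'] ->.
  by have := entry_domK q'; rewrite -pq' /= => ->.
have /andP[q1 q2] := s_can q qs.
exists (Sub q.1 q1, Sub q.2 q2); last by rewrite /entry_tree /= -surjective_pairing.
rewrite !inE /= mem_pmap; apply/mapP; exists q => //.
by rewrite /entry_dom !insubT.
Qed.

Lemma dom_ind (P : dom -> Prop) :
  (forall n, P (dint n)) ->
  (forall t : {fset dom * dom},
     (forall d d' : dom, (d, d') \in t -> P d /\ P d') -> P (dtab t)) ->
  forall d, P d.
Proof.
move=> Pint Ptab [r]; elim/tree_nested_ind: r => [n|s IHs] cr.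
  rewrite (_ : exist _ _ _ = dint n); first exact: Pint.
  exact: val_inj.
rewrite -(dom_viewK (exist _ (TTab s) cr)) /=; apply: Ptab => d d'.
rewrite !inE /= mem_pmap => /mapP[q qs dq].
have := entry_domK q; rewrite -dq /= => qE.
have := IHs (index q s); rewrite index_mem nth_index // -qE /=.
rewrite qE => /(_ qs)[IH1 IH2].
by case: d d' {dq qE} IH1 IH2 => [a a_can] [b b_can] /= IH1 IH2; split.
Qed.

Definition dle (d d' : dom) : Prop :=
  match dom_view d, dom_view d' with
  | inl n, inl n' => n = n'
  | inr t, inr t' => t `<=` t'
  | _, _ => False
  end.

Definition env : Type := nat -> option dom.

Definition env_empty : env := fun _ => None.

Definition env_upd (rho : env) (x : nat) (d : dom) : env :=
  fun y => if y == x then Some d else rho y.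

Local Open Scope classical_set_scope.

Fixpoint denot (e : expr) (rho : env) : set dom :=
  match e with
  | ENum n => [set dint n]
  | EVar x => [set d | exists2 d', rho x = Some d' & dle d d']
  | EOp op e1 e2 =>
      [set d | exists n1 n2 : int,
         [/\ denot e1 rho (dint n1), denot e2 rho (dint n2)
           & d = dint (op n1 n2)]]
  | ELam x e1 =>
      [set d | exists2 t : {fset dom * dom}, d = dtab t &
         forall d1 d2, (d1, d2) \in t -> denot e1 (env_upd rho x d1) d2]
  | EApp e1 e2 =>
      [set d | exists (t : {fset dom * dom}) (d1 d1' d2 : dom),
         [/\ denot e1 rho (dtab t), denot e2 rho d2, (d1, d1') \in t,
             dle d1 d2 & dle d d1']]
  | EIf e1 e2 e3 =>
      [set d | exists n : int,
         [/\ denot e1 rho (dint n), n <> 0%R -> denot e2 rho d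
           & n = 0%R -> denot e3 rho d]]
  end.

Inductive value : Type :=
| VInt (n : int)
| VClo (x : nat) (e : expr) (r : {fmap nat -> value}).

Inductive bigstep : {fmap nat -> value} -> expr -> value -> Prop :=
| BNum r n : bigstep r (ENum n) (VInt n)
| BVar (r : {fmap nat -> value}) x v : (r.[? x])%fmap = Some v -> bigstep r (EVar x) v
| BLam r x e : bigstep r (ELam x e) (VClo x e r)
| BOp r op e1 e2 n1 n2 :
    bigstep r e1 (VInt n1) -> bigstep r e2 (VInt n2) ->
    bigstep r (EOp op e1 e2) (VInt (op n1 n2))
| BApp r e1 e2 x e (r' : {fmap nat -> value}) v2 v :
    bigstep r e1 (VClo x e r') -> bigstep r e2 v2 ->
    bigstep (r'.[x <- v2])%fmap e v ->
    bigstep r (EApp e1 e2) v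
| BIfTrue r e1 e2 e3 n v :
    bigstep r e1 (VInt n) -> n <> 0%R -> bigstep r e2 v ->
    bigstep r (EIf e1 e2 e3) v
| BIfFalse r e1 e2 e3 v :
    bigstep r e1 (VInt 0%R) -> bigstep r e3 v ->
    bigstep r (EIf e1 e2 e3) v.

(* Main.v *)
Require Import Defs.
From mathcomp Require Import all_boot all_algebra finmap.
From mathcomp Require Import boolp classical_sets.

(** Relate an integer to itself, and a table [t] to a closure when every entry
    [(d1, d2)] of [t] sends the values related to [d1] to evaluations of the
    body with a result related to [d2].  This relation is downward closed in
    the denotation, and by induction on [e] every element of [denot e rho] is
    realized by some value of [e] in any environment related to [rho].  The
    element [n] can only be realized by the value [n]. *)

Fixpoint tree_realizer (r : tree) (v : value) : Prop :=
  match r, v with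
  | TInt n, VInt m => m = n
  | TTab s, VClo x e r' =>
      foldr (fun p P =>
        (forall v1, tree_realizer p.1 v1 -> exists2 v2,
           bigstep (r'.[x <- v1])%fmap e v2 & tree_realizer p.2 v2) /\ P) True s
  | _, _ => False
  end.

Definition realizer (d : dom) (v : value) : Prop := tree_realizer (val d) v.

(** Turns the table case of [tree_realizer] into quantification over entries; the [foldr] there
    keeps the nested recursive calls structural. *)
Lemma foldr_andP (T : eqType) (Q : T -> Prop) (s : seq T) :
  foldr (fun p P => Q p /\ P) True s <-> (forall p, p \in s -> Q p).
Proof.
elim: s => [|a s IHs] /=; first by split.
split=> [[Qa /IHs Qs] p|Qs].
  by rewrite inE => /predU1P[->|/Qs].
split; first by apply: Qs; rewrite mem_head.
by apply/IHs => p ps; apply: Qs; rewrite inE ps orbT.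
Qed.

Lemma realizer_dint n v : realizer (dint n) v -> v = VInt n.
Proof. by case: v => //= m ->. Qed.

Lemma realizer_dtab_clo t v :
  realizer (dtab t) v -> exists x e r, v = VClo x e r.
Proof. by case: v => // x e r _; exists x, e, r. Qed.

(** Sorting [t] into its canonical list keeps its members, so the order of the entries is
    irrelevant. *)
Lemma realizer_dtabP t x e r :
  realizer (dtab t) (VClo x e r) <->
  (forall d1 d2, (d1, d2) \in t -> forall v1, realizer d1 v1 ->
     exists2 v2, bigstep (r.[x <- v1])%fmap e v2 & realizer d2 v2).
Proof.
rewrite /realizer /=; apply: (iff_trans (foldr_andP _ _ _)).
split=> [H d1 d2 d12t|H p].
  by apply: (H (entry_tree (d1, d2))); rewrite sort_keysE map_f.
by rewrite sort_keysE => /mapP[[d1 d2] d12t ->]; exact: H d12t.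
Qed.

(** A smaller table imposes fewer conditions on a closure, and comparable integers are equal. *)
Lemma realizer_dle d d' v : dle d d' -> realizer d' v -> realizer d v.
Proof.
rewrite -(dom_viewK d) -(dom_viewK d') /dle.
case: (dom_view d) => [n|t]; case: (dom_view d') => [n'|t'];
  rewrite /dom_of_view ?dint_view ?dtab_view //; first by move=> ->.
move=> /fsubsetP tt' t'v; have [x [e [r vE]]] := realizer_dtab_clo _ _ t'v.
move: t'v; rewrite vE => /realizer_dtabP t'v.
by apply/realizer_dtabP => d1 d2 /tt'; exact: t'v.
Qed.

Definition env_realizer (rho : env) (r : {fmap nat -> value}) : Prop :=
  forall x d, rho x = Some d -> exists2 v, (r.[? x])%fmap = Some v & realizer d v.

Lemma env_realizer_upd rho r x d v :
  env_realizer rho r -> realizer d v ->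
  env_realizer (env_upd rho x d) (r.[x <- v])%fmap.
Proof.
move=> rho_r dv y d'; rewrite /env_upd fnd_set.
by case: eqP => [_ [<-]|_ /rho_r //]; exists v.
Qed.

(** The induction on [e] keeps both environments general, since the lambda case extends them
    together. *)
Lemma denot_realized e rho r d :
  env_realizer rho r -> denot e rho d ->
  exists2 v, bigstep r e v & realizer d v.
Proof.
elim: e rho r d => [n|op e1 IH1 e2 IH2|x|x e IH|e1 IH1 e2 IH2|
                    e1 IH1 e2 IH2 e3 IH3] rho r d rho_r /=.
- by move=> ->; exists (VInt n) => //; exact: BNum.
- move=> [n1 [n2 [/(IH1 _ _ _ rho_r)[v1 ev1 /realizer_dint v1E]]]].
  move=> /(IH2 _ _ _ rho_r)[v2 ev2 /realizer_dint v2E] ->.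
  rewrite v1E in ev1; rewrite v2E in ev2.
  by exists (VInt (op n1 n2)) => //; exact: BOp.
- move=> [d' /rho_r[v rxv d'v] dd'].
  by exists v; [exact: BVar | exact: realizer_dle d'v].
(* One closure realizes every table [t] of the abstraction: each entry is an instance of the
   induction hypothesis for the body. *)
- move=> [t -> te]; exists (VClo x e r); first exact: BLam.
  apply/realizer_dtabP => d1 d2 /te d2e v1 dv1.
  by apply: IH d2e; exact: env_realizer_upd.
- move=> [t [d1 [d1' [d2 [/(IH1 _ _ _ rho_r)[v1 ev1 tv1]]]]]].
  move=> /(IH2 _ _ _ rho_r)[v2 ev2 dv2] d1t d12 dd1'.
  have [x [e [r' v1E]]] := realizer_dtab_clo _ _ tv1.
  (* As [v2] realizes [d2], it realizes the smaller [d1], so the entry [(d1, d1')] yields an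
     evaluation of the closure body. *)
  rewrite v1E in ev1 tv1; move/realizer_dtabP: tv1 => /(_ _ _ d1t v2).
  move=> /(_ (realizer_dle _ _ _ d12 dv2))[v ev d1'v].
  by exists v; [exact: BApp ev1 ev2 ev | exact: realizer_dle d1'v].
- move=> [n [/(IH1 _ _ _ rho_r)[v1 ev1 /realizer_dint v1E] then_d else_d]].
  rewrite v1E in ev1; have [n0|/eqP n0] := eqVneq n 0%R.
    have [v ev dv] := IH3 _ _ _ rho_r (else_d n0).
    by exists v => //; apply: BIfFalse ev; rewrite -n0.
  have [v ev dv] := IH2 _ _ _ rho_r (then_d n0).
  by exists v => //; exact: BIfTrue ev1 n0 ev.
Qed.

Theorem theorem2 (e : expr) (n : int) :
  denot e env_empty = denot (ENum n) env_empty ->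
  bigstep [fmap]%fmap e (VInt n).
Proof.
move=> eE; have en : denot e env_empty (dint n) by rewrite eE.
have [|v ev /realizer_dint vE] := @denot_realized _ _ ([fmap])%fmap _ _ en.
  (* [env_empty] binds no variable, so the empty environments are related vacuously. *)
  by move=> x d.
by rewrite -vE.
Qed.
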